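(* Let $n\ge 1$ and let $T:\mathbb{R}^{n+1}\to\mathbb{R}^{n+1}$ be the multidimensional Hénon map $(x,y)\mapsto(\bar x,\bar y)$ given by $$\bar x=\mu-x^2+\sum_{i=1}^n y_i,\qquad \bar y_1=bx,\qquad \bar y_{i+1}=a_i y_i\quad (i=1,\dots,n-1),$$ where $|b|<1$ and $|a_i|<a<1$ for $i=1,\dots,n-1$. Let $\gamma>0$ be the constant determined by $\gamma=\dfrac{\alpha|b|}{1-a}$ with $\alpha=\mu-\gamma$, that is, $\gamma=\dfrac{\mu|b|}{1-a+|b|}$. If $$\sqrt{2(\mu+\gamma)}<\mu-\gamma,$$ then the map $T$ has a topological Smale horseshoe.
   Context: Here $x\in\mathbb{R}$ and $y=(y_1,\dots,y_n)\in\mathbb{R}^n$. The constant $\gamma$ is the one defining the domain $D_\alpha=\{(x,y): |x|<\mu-\gamma,\ \sum_{i=1}^n|y_i|<\gamma\}$. A topological Smale horseshoe of $T$ is understood in the standard sense of topological horseshoes: a compact set $\Lambda\subset\mathbb{R}^{n+1}$ with $T(\Lambda)=\Lambda$ for which there is a continuous surjection $h:\Lambda\to\{0,1\}^{\mathbb{N}}$ with $h\circ T=\sigma\circ h$, where $\sigma$ is the shift on the space of one-sided sequences of two symbols.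
   Formalization: The bound a is assumed nonnegative; this is automatic for n ≥ 2, but for n = 1 there are no a_i and a very negative a would make the claim false (e.g. b = −0.9, μ = 2.1, where the period-2 points are not real). *)

(* Defs.v *)
From HB Require Import structures.
From mathcomp Require Import all_boot all_order all_algebra.
From mathcomp Require Import all_classical all_reals all_analysis.

Set Implicit Arguments.
Unset Strict Implicit.
Unset Printing Implicit Defensive.

Import Order.TTheory GRing.Theory Num.Theory.
Import numFieldNormedType.Exports.

Local Open Scope classical_set_scope.
Local Open Scope ring_scope.

(* R^(n+1) is R * 'rV[R]_n.  Vector indices start at 0, so y_i is y 0 (i - 1),
   whereas the coefficients keep their indices: a_ i is a_i, and only
   a_ 1, ..., a_ (n - 1) are used.  For 0 < j, ord_pred j has value j - 1, so
   entry j of the new vector is a_ j * y_j. *)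
Definition henon (R : realType) (n : nat) (mu b : R) (a_ : nat -> R)
    (p : R * 'rV[R]_n) : R * 'rV[R]_n :=
  (mu - p.1 ^+ 2 + \sum_(i < n) p.2 0 i,
   \row_(j < n) if j == 0%N :> nat then b * p.1
                else a_ j * p.2 0 (ord_pred j)).

(* cantor_space is nat -> bool with the product of the discrete topologies. *)
Definition shift (s : cantor_space) : cantor_space := fun k : nat => s k.+1.

(* The values of h outside Lambda are irrelevant. *)
Definition has_topological_horseshoe (X : topologicalType) (T : X -> X) : Prop :=
  exists (Lambda : set X) (h : X -> cantor_space),
    [/\ compact Lambda,
        T @` Lambda = Lambda,
        {within Lambda, continuous h},
        h @` Lambda = [set: cantor_space]
      & forall p, Lambda p -> h (T p) = shift (h p)].

(* Main.v *)
Require Import Defs.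
From HB Require Import structures.
From mathcomp Require Import all_boot all_order all_algebra.
From mathcomp Require Import all_classical all_reals all_analysis.
From mathcomp Require Import lra.
Import Order.TTheory GRing.Theory Num.Theory.
Import numFieldNormedType.Exports.
Local Open Scope classical_set_scope.
Local Open Scope ring_scope.

(** Put S = {(x, y) : sum |y_i| <= gamma}.  The choice of gamma makes this slab
    stable: if |x| <= alpha on S, then the new y satisfies
    sum |y_i| <= |b| alpha + a gamma = gamma ([henon_l1_bound]).  On S the new
    x-coordinate lies within gamma of mu - x^2.  Hence at x = 0 it is at least
    mu - gamma = alpha, whereas at x = alpha and at x = - alpha it is at most
    mu + gamma - alpha^2 < - (mu + gamma) < - alpha; the hypothesis on the
    square root says that alpha^2 > 2 (mu + gamma).  So T folds the
    domain |x| <= alpha of S: each of its halves x <= 0 and 0 <= x is stretched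
    across the whole domain.

    Given a word of symbols (false for the left half, true for the right one),
    take any curve in S that joins x <= - alpha to x >= alpha.  By the
    intermediate value theorem some sub-arc crosses exactly the half prescribed
    by the first letter, and its image under T is again a curve in S that joins
    x <= - alpha to x >= alpha, up to orientation.  Iterating, some point of the
    first curve visits the halves in the order of the word
    ([word_along_curve]).  Only this crossing property of curves is used, so the
    argument needs no hyperbolicity and works in every dimension.

    The rest is compactness and holds for continuous maps of Hausdorff spaces
    ([horseshoe_of_words]).  Infinite words are realized because finite
    ones are.  The halves meet only in x = 0, and the orbit of such a point
    leaves the domain after two steps, so a point that stays in the domain has
    one itinerary, which depends continuously on the point.  The horseshoe
    consists of the points that stay in the domain and have arbitrarily long
    pasts there; it is a decreasing intersection of compact sets, which gives
    both T(Lambda) = Lambda and the surjectivity of the itinerary map on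
    Lambda. *)

(** * Compactness and the Cantor space *)

Lemma nested_compact_nonempty (X : topologicalType) (K : nat -> set X) :
  compact (K 0%N) -> (forall k, closed (K k)) ->
  (forall k, K k.+1 `<=` K k) -> (forall k, K k !=set0) ->
  exists p, forall k, K k p.
Proof.
move=> K0 Kcl Kdec Kne.
have Kle i j : (i <= j)%N -> K j `<=` K i.
  move=> /subnK <-; elim: (j - i)%N => [//|d IHd].
  exact: subset_trans (Kdec _) IHd.
have FF : ProperFilter (filter_from setT K).
  apply: (filter_from_proper (filter_from_filter _ _)) => [|i j _ _|i _].
  - by exists 0%N.
  - exists (maxn i j) => // x Kx.
    by split; apply: Kle Kx; [exact: leq_maxl|exact: leq_maxr].
  - exact: Kne.
have [|p [_ clp]] := K0 _ FF; first by exists 0%N.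
exists p => k; apply: (Kcl k) => B pB; apply: clp pB.
by exists k.
Qed.

Lemma continuous_iter (X : topologicalType) (T : X -> X) k :
  continuous T -> continuous (iter k T).
Proof.
move=> cT; elim: k => [|k IHk] x; first exact: cvg_id.
by apply: (@continuous_comp _ _ _ (iter k T) T); [exact: IHk|exact: cT].
Qed.

Lemma cvg_cantor (F : set_system cantor_space) (s : cantor_space) :
  Filter F -> (forall k, \forall t \near F, t k = s k) -> F --> s.
Proof.
move=> FF Fs; apply/cvg_sup => k U [V [[W _ <-] Ws] sVU].
by apply: filterS sVU _; apply: filterS (Fs k) => t /= ->.
Qed.

(** * Coding by itineraries *)

Definition follows {X : Type} (T : X -> X) (D : bool -> set X)
    (s : nat -> bool) : set X :=
  [set p | forall k, D (s k) (iter k T p)].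

(** The itinerary of a point whose k-th iterate has itinerary s; the letters
    before s are arbitrary. *)
Definition delay (s : nat -> bool) (k : nat) : nat -> bool :=
  fun j => if (j < k)%N then false else s (j - k)%N.

Section Coding.
Variables (X : topologicalType) (T : X -> X) (D : bool -> set X).
Hypotheses (X_hausdorff : hausdorff_space X) (cT : continuous T).
Hypothesis (D_compact : forall b, compact (D b)).
Hypothesis words_realized : forall (s : nat -> bool) k,
  exists p, forall j, (j <= k)%N -> D (s j) (iter j T p).
(* Weaker than disjointness, so that the two sets can be closed halves that
   share a face. *)
Hypothesis symbols_separate : forall (s : nat -> bool) p,
  D true p -> D false p -> ~ follows T D s (T p).

Lemma closed_visit b k : closed [set p | D b (iter k T p)].
Proof.
apply: (@preimage_closed _ _ (iter k T)).
  by move=> x _; exact: continuous_iter.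
exact: compact_closed.
Qed.

Lemma follows_shift s p :
  follows T D s p -> follows T D (fun k => s k.+1) (T p).
Proof. by move=> sp k; rewrite -iterSr; exact: sp. Qed.

Lemma follows_iter s p i : follows T D s p ->
  follows T D (fun k => s (k + i)%N) (iter i T p).
Proof. by move=> sp k; rewrite -iterD; exact: sp. Qed.

(** If two itineraries differ at time k, the k-th iterate lies in both sets. *)
Lemma follows_inj s t p : follows T D s p -> follows T D t p -> s = t.
Proof.
move=> sp tp; apply/funext => k.
have := follows_iter s p k.+1 sp; rewrite iterS.
have := sp k; have := tp k.
by case: (s k); case: (t k) => // D1 D2 /symbols_separate; case.
Qed.

Lemma follows_closed s : closed (follows T D s).
Proof.
have -> : follows T D s = \bigcap_k [set p | D (s k) (iter k T p)].
  by apply/seteqP; split=> [p sp k _|p sp k]; apply: sp.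
by apply: closed_bigI => k _; exact: closed_visit.
Qed.

Lemma follows_compact s : compact (follows T D s).
Proof.
apply: subclosed_compact (follows_closed s) (D_compact (s 0%N)) _ => p.
exact.
Qed.

Lemma follows_nonempty s : follows T D s !=set0.
Proof.
pose K k := [set p | forall j, (j <= k)%N -> D (s j) (iter j T p)].
have [||||p Kp] := @nested_compact_nonempty X K.
- have -> : K 0%N = D (s 0%N).
    by apply/seteqP; split=> [p /(_ 0%N)|p Dp []//]; apply.
  exact: D_compact.
- move=> k.
  have -> : K k =
      \bigcap_(j in [set j | (j <= k)%N]) [set p | D (s j) (iter j T p)].
    by apply/seteqP; split=> p Kp j; exact: Kp.
  by apply: closed_bigI => j _; exact: closed_visit.
- by move=> k p Kp j jk; apply: Kp; exact: leqW.
- exact: words_realized.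
by exists p => k; exact: (Kp k).
Qed.

Definition trapped_set : set X := [set p | exists s, follows T D s p].

(** Each letter can be chosen separately, which makes the trapped set an
    intersection of closed sets. *)
Lemma trapped_setE : trapped_set =
  \bigcap_k [set p | D true (iter k T p) \/ D false (iter k T p)].
Proof.
apply/seteqP; split=> [p [s sp] k _ /=|p Dp].
  by have := sp k; case: (s k); [left|right].
exists (fun k => `[< D true (iter k T p) >]) => k.
by case: asboolP => // nD; case: (Dp k I).
Qed.

Lemma closed_fiber p : closed (T @^-1` [set p]).
Proof.
apply: preimage_closed => [x _|]; first exact: cT.
by apply: compact_closed => //; exact: compact_set1.
Qed.

Lemma trapped_set_compact : compact trapped_set.
Proof.
apply: (@subclosed_compact _ _ (D true `|` D false)).
- rewrite trapped_setE; apply: closed_bigI => k _.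
  by apply: closedU; exact: closed_visit.
- exact: compactU.
- by rewrite trapped_setE => p /(_ 0%N I).
Qed.

Lemma trapped_setT p : trapped_set p -> trapped_set (T p).
Proof. by move=> [s /follows_shift]; exists (fun k => s k.+1). Qed.

(** The maximal invariant part of the trapped set, described by pasts of every
    finite length; [image_invariant_set] shows that these fit together. *)
Definition invariant_set : set X :=
  [set p | forall k, (iter k T @` trapped_set) p].

Lemma invariant_set_sub : invariant_set `<=` trapped_set.
Proof. by move=> p /(_ 0%N)[q Lq <-]. Qed.

Lemma image_iter_closed k A : compact A -> closed (iter k T @` A).
Proof.
move=> cA; apply: compact_closed => //; apply: continuous_compact cA.
exact/continuous_subspaceT/continuous_iter.
Qed.

Lemma invariant_set_compact : compact invariant_set.
Proof.
apply: subclosed_compact trapped_set_compact invariant_set_sub.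
have -> : invariant_set = \bigcap_k (iter k T @` trapped_set).
  by apply/seteqP; split=> p Ip k; move=> *; exact: Ip.
by apply: closed_bigI => k _; exact/image_iter_closed/trapped_set_compact.
Qed.

(** For p with pasts of every length, the preimages of p that have a past of
    length k form a decreasing sequence of nonempty compact sets; a point common
    to all of them is a preimage of p in the invariant set. *)
Lemma image_invariant_set : T @` invariant_set = invariant_set.
Proof.
apply/seteqP; split=> [_ [p Ip <-] k|p Ip].
  have [q Lq <-] := Ip k; exists (T q); first exact: trapped_setT.
  by rewrite -iterSr.
pose K k := (iter k T @` trapped_set) `&` T @^-1` [set p].
have [||||q Kq] := @nested_compact_nonempty X K.
- rewrite /K; apply: compact_closedI.
    by rewrite image_id; exact: trapped_set_compact.
  exact: closed_fiber.
- move=> k; apply: closedI.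
    exact/image_iter_closed/trapped_set_compact.
  exact: closed_fiber.
- move=> k _ [[q Lq <-] Tq]; split=> //.
  by exists (T q); [exact: trapped_setT|rewrite -iterSr].
- move=> k; have [q Lq qp] := Ip k.+1.
  by exists (iter k T q).
exists q; last by have [] := Kq 0%N.
by move=> k; have [] := Kq k.
Qed.

Definition itinerary (p : X) : cantor_space :=
  fun k => `[< D true (iter k T p) >].

Lemma follows_itinerary s p : follows T D s p -> itinerary p = s.
Proof.
move=> sp; apply: follows_inj (sp) => k; rewrite /itinerary.
by case: asboolP => // nD; have := sp k; case: (s k).
Qed.

(** Near p, the k-th iterate avoids the closed set of the other letter, so
    each letter of the itinerary is locally constant. *)
Lemma itinerary_continuous : {within invariant_set, continuous itinerary}.
Proof.
apply/subspace_continuousP => p Ip; apply: cvg_cantor => k.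
have [s sp] := invariant_set_sub p Ip.
have sE := follows_itinerary s p sp.
have nD : ~ D (~~ s k) (iter k T p).
  have := follows_iter s p k.+1 sp; rewrite iterS => + Dk; have := sp k.
  by move: Dk; case: (s k) => /= D1 D2 /symbols_separate; case.
have : nbhs p (~` [set q | D (~~ s k) (iter k T q)]).
  by apply: open_nbhs_nbhs; split=> //; exact/closed_openC/closed_visit.
rewrite /from_subspace sE; apply: filterS => q nDq Iq.
have [t tq] := invariant_set_sub q Iq; rewrite /= (follows_itinerary t q tq).
by move: nDq (tq k) => /=; case: (s k); case: (t k).
Qed.

(** The k-th iterates of the points with itinerary [delay s k] have itinerary s
    and a past of length k; these sets decrease with k and are compact. *)
Lemma itinerary_surjective : itinerary @` invariant_set = [set: cantor_space].
Proof.
apply/seteqP; split=> // s _.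
pose K k := iter k T @` follows T D (delay s k).
have delayS k : (fun j => delay s k.+1 j.+1) = delay s k by apply/funext => j.
have [||||p Kp] := @nested_compact_nonempty X K.
- by rewrite /K image_id; exact: follows_compact.
- by move=> k; exact/image_iter_closed/follows_compact.
- move=> k _ [q sq <-]; have := follows_shift _ _ sq; rewrite delayS => sTq.
  by exists (T q) => //; rewrite -iterSr.
- move=> k; have [q sq] := follows_nonempty (delay s k).
  by exists (iter k T q), q.
exists p.
  by move=> k; have [q sq <-] := Kp k; exists q => //; exists (delay s k).
have [q sq <-] := Kp 0%N; apply: follows_itinerary => k.
by have := sq k; rewrite /delay subn0.
Qed.

Theorem horseshoe_of_words : has_topological_horseshoe T.
Proof.
exists invariant_set, itinerary; split.
- exact: invariant_set_compact.
- exact: image_invariant_set.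
- exact: itinerary_continuous.
- exact: itinerary_surjective.
- by move=> p _; apply/funext => k; rewrite /itinerary /shift -iterSr.
Qed.

End Coding.

(** * Crossings of an interval *)

Lemma IVT_pair (R : realType) (f : R -> R) (u v A : R) :
  continuous f -> u <= v -> f u <= A <= f v ->
  exists2 c, u <= c <= v & f c = A.
Proof.
move=> cf uv /andP[fuA Afv].
have [||c] := @IVT R f u v A uv; first exact: continuous_subspaceT.
  by rewrite ge_min fuA le_max Afv orbT.
by rewrite in_itv => cuv <-; exists c.
Qed.

Lemma level_set_compact (R : realType) (f : R -> R) (u v A : R) :
  continuous f -> compact ([set` `[u, v]] `&` f @^-1` [set A]).
Proof.
move=> cf; apply: compact_closedI; first exact: segment_compact.
by apply: preimage_closed => [x _|]; [exact: cf|exact: closed_eq].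
Qed.

(** The sub-interval ends at the first point v' where f takes the value B and
    starts at the last point before v' where f takes the value A; both exist
    because level sets are compact, and between them f cannot leave [A, B]
    without taking one of these values again. *)
Lemma crossing_subinterval (R : realType) (f : R -> R) (u v A B : R) :
  continuous f -> u <= v -> A <= B -> f u <= A -> B <= f v ->
  exists u' v', [/\ u <= u' <= v', v' <= v, f u' = A, f v' = B &
    forall t, u' <= t <= v' -> A <= f t <= B].
Proof.
move=> cf uv AB fuA Bfv.
have cid (S : set R) : {within S, continuous (@idfun R)}.
  by apply: continuous_subspaceT => x; exact: cvg_id.
have [w uwv fwB] : exists2 w, u <= w <= v & f w = B.
  by apply: IVT_pair => //; rewrite Bfv (le_trans fuA).
have [|v' /set_mem[/= v'uv fv'] v'min] :=
    compact_EVT_min _ (level_set_compact R f u v B cf) (cid _).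
  by exists w; split=> //=; rewrite in_itv.
move: v'uv; rewrite in_itv /= => /andP[uv' v'v].
have [z uzv' fzA] : exists2 z, u <= z <= v' & f z = A.
  by apply: IVT_pair => //; rewrite fuA fv'.
have [|u' /set_mem[/= u'uv' fu'] u'max] :=
    compact_EVT_max _ (level_set_compact R f u v' A cf) (cid _).
  by exists z; split=> //=; rewrite in_itv.
move: u'uv'; rewrite in_itv /= => /andP[uu' u'v'].
exists u', v'; split=> // [|t /andP[u't tv']]; first exact/andP.
apply/andP; split.
  rewrite leNgt; apply/negP => ftA.
  have [c /andP[tc cv'] fcA] : exists2 c, t <= c <= v' & f c = A.
    by apply: IVT_pair => //; rewrite (ltW ftA) fv'.
  have /u'max : c \in [set` `[u, v']] `&` f @^-1` [set A].
    rewrite inE; split=> //=.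
    by rewrite in_itv /= cv' (le_trans uu') ?(le_trans u't).
  rewrite /= => cu'.
  have ct : c = t by apply/eqP; rewrite eq_le tc (le_trans cu').
  by move: ftA; rewrite -ct fcA ltxx.
rewrite leNgt; apply/negP => Bft.
have ut := le_trans uu' u't.
have [c /andP[uc ct] fcB] : exists2 c, u <= c <= t & f c = B.
  by apply: IVT_pair => //; rewrite (ltW Bft) (le_trans fuA).
have /v'min : c \in [set` `[u, v]] `&` f @^-1` [set B].
  rewrite inE; split=> //=.
  by rewrite in_itv /= uc (le_trans ct) ?(le_trans tv').
rewrite /= => v'c.
have tc : c = t by apply/eqP; rewrite eq_le ct (le_trans tv').
by move: Bft; rewrite -tc fcB ltxx.
Qed.

(** * Curves across a folded slab *)

Section Folding.
Variables (R : realType) (X : topologicalType) (T : X -> X).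
Variables (x : X -> R) (S : set X) (alpha : R).

Definition half_slab (b : bool) : set X :=
  [set p | S p /\ if b then 0 <= x p <= alpha else - alpha <= x p <= 0].

Hypotheses (cT : continuous T) (cx : continuous x).
Hypothesis alpha_ge0 : 0 <= alpha.
Hypothesis S_stable : forall p, S p -> - alpha <= x p <= alpha -> S (T p).
(* The image of a half of the slab covers the slab: its inner face x = 0 and its
   outer face go to opposite sides. *)
Hypothesis center_out : forall p, S p -> x p = 0 -> alpha <= x (T p).
(* Strict, so that no orbit that passes through the face x = 0 can stay in the
   slab. *)
Hypothesis sides_out : forall p,
  S p -> x p = - alpha \/ x p = alpha -> x (T p) < - alpha.

Lemma half_slab_bound b p : half_slab b p -> S p /\ - alpha <= x p <= alpha.
Proof.
move=> [Sp xp]; split=> //; move: xp (alpha_ge0).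
by case: b => /andP[x1 x2] a0; apply/andP; split; lra.
Qed.

Lemma half_slab_stable b p : half_slab b p -> S (T p).
Proof. by case/half_slab_bound; exact: S_stable. Qed.

Lemma subarc_across_half (b : bool) (c : R -> X) (u v : R) :
  continuous c -> u <= v -> (forall t, u <= t <= v -> S (c t)) ->
  x (c u) <= - alpha -> alpha <= x (c v) ->
  exists u' v', [/\ u <= u' <= v', v' <= v,
    x (c u') = (if b then 0 else - alpha),
    x (c v') = (if b then alpha else 0) &
    forall t, u' <= t <= v' -> half_slab b (c t)].
Proof.
move=> cc uv Sc xu xv.
have cxc : continuous (x \o c).
  by move=> t; apply: continuous_comp; [exact: cc|exact: cx].
have [|||u' [v' [/andP[uu' u'v'] v'v xu' xv' xAB]]] :=
  @crossing_subinterval R (x \o c) u v (if b then 0 else - alpha)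
    (if b then alpha else 0) cxc uv.
- by case: b; rewrite // oppr_le0.
- by case: b => //; apply: le_trans xu _; rewrite oppr_le0.
- by case: b => //; exact: le_trans xv.
exists u', v'; split=> //; first exact/andP.
move=> t /[dup] /andP[u't tv'] /xAB xt; split; last by case: b xt {xu' xv' xAB}.
by apply: Sc; rewrite (le_trans uu') ?(le_trans tv').
Qed.

(** Induction on the word: the image under T of the sub-arc that crosses the
    half named by the first letter is again a curve across the slab. *)
Lemma word_along_curve k (s : nat -> bool) (c : R -> X) (u v : R) :
  continuous c -> u <= v -> (forall t, u <= t <= v -> S (c t)) ->
  x (c u) <= - alpha -> alpha <= x (c v) ->
  exists2 t, u <= t <= v &
    forall j, (j <= k)%N -> half_slab (s j) (iter j T (c t)).
Proof.
elim: k s c u v => [|k IHk] s c u v cc uv Sc xu xv;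
  have [u' [v' [/andP[uu' u'v'] v'v xu' xv' s0c]]] :=
    subarc_across_half (s 0%N) c u v cc uv Sc xu xv.
  exists u'; first by rewrite uu' (le_trans u'v').
  by move=> [|//] _; apply: s0c; rewrite lexx.
have cTc : continuous (T \o c).
  by move=> t; apply: continuous_comp; [exact: cc|exact: cT].
have STc t : u' <= t <= v' -> S ((T \o c) t).
  by move=> tuv; exact: half_slab_stable (s0c t tuv).
have [Su' _] : half_slab (s 0%N) (c u') by apply: s0c; rewrite lexx.
have [Sv' _] : half_slab (s 0%N) (c v') by apply: s0c; rewrite u'v' lexx.
suff [t tuv Ht] : exists2 t, u' <= t <= v' & forall j, (j <= k)%N ->
    half_slab (s j.+1) (iter j T ((T \o c) t)).
  exists t.
    by case/andP: tuv => ? ?; rewrite (le_trans uu') ?(le_trans _ v'v).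
  by move=> [|j] jk; [exact: s0c|rewrite iterSr; exact: Ht].
(* The right half is folded back, so its image is traversed backwards. *)
case: (s 0%N) xu' xv' {s0c} => xu' xv'.
  have [|||||t tuv Ht] := IHk (fun j => s j.+1) (T \o c \o -%R) (- v') (- u').
  - by move=> t; apply: continuous_comp; [exact: opp_continuous|exact: cTc].
  - by rewrite lerN2.
  - by move=> t; rewrite lerNl lerNr andbC; exact: STc.
  - by rewrite /= opprK; apply/ltW/sides_out => //; right.
  - by rewrite /= opprK; exact: center_out.
  by exists (- t) => //; rewrite lerNl lerNr andbC.
apply: IHk => //=; first by apply/ltW/sides_out => //; left.
exact: center_out.
Qed.

Theorem folding_horseshoe (c : R -> X) (u v : R) :
  hausdorff_space X ->
  compact (S `&` [set p | - alpha <= x p <= alpha]) ->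
  continuous c -> u <= v -> (forall t, u <= t <= v -> S (c t)) ->
  x (c u) <= - alpha -> alpha <= x (c v) ->
  has_topological_horseshoe T.
Proof.
move=> hX Scpt cc uv Sc xu xv.
apply: (@horseshoe_of_words X T half_slab) => //.
- move=> b.
  have -> : half_slab b = (S `&` [set p | - alpha <= x p <= alpha]) `&`
      x @^-1` (if b then [set r | 0 <= r] else [set r | r <= 0]).
    apply/seteqP; split=> p.
      move=> hp; have [Sp xp] := half_slab_bound _ _ hp; split=> //.
      by case: hp => _; case: b => /andP[].
    by move=> [[Sp /andP[x1 x2]]]; case: b => /= x3; split=> //; apply/andP.
  apply: compact_closedI => //.
  apply: preimage_closed => [p _|]; first exact: cx.
  by case: b; [exact: closed_ge|exact: closed_le].
- move=> s k; have [t _ Ht] := word_along_curve k s c u v cc uv Sc xu xv.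
  by exists (c t).
(* A common point of the halves has x = 0, so T maps it to x = alpha, and the
   next step leaves the slab. *)
move=> s p [Sp /andP[xp _]] [_ /andP[_ px]] sTp.
have xp0 : x p = 0 by apply/eqP; rewrite eq_le xp px.
have [STp /andP[_ xTp]] := half_slab_bound _ _ (sTp 0%N).
have [_ /andP[+ _]] := half_slab_bound _ _ (sTp 1%N).
rewrite leNgt => /negP; apply; apply: sides_out => //; right.
by apply/eqP; rewrite eq_le xTp center_out.
Qed.

End Folding.

(** * The multidimensional Henon map *)

Lemma cvg_mx (T U : topologicalType) m n (F : set_system T)
    (f : T -> 'M[U]_(m, n)) (M : 'M[U]_(m, n)) : Filter F ->
  (forall i j, f x i j @[x --> F] --> M i j) -> f @ F --> M.
Proof.
move=> FF fM S [P MP sPS].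
have : \forall x \near F, forall i j, P i j (f x i j).
  apply: filter_forall => i; apply: filter_forall => j.
  exact: fM (MP i j).
by apply: filterS => x Px; exact: sPS.
Qed.

Lemma entry_continuous (R : realType) (n : nat) (j : 'I_n) :
  continuous (fun p : R * 'rV[R]_n => p.2 0 j).
Proof.
move=> p; apply: (@continuous_comp _ _ _ snd (fun M : 'rV[R]_n => M 0 j)).
  exact: cvg_snd.
exact: coord_continuous.
Qed.

Lemma henon_continuous (R : realType) (n : nat) (mu b : R) (a_ : nat -> R) :
  continuous (@henon R n mu b a_).
Proof.
have cx : continuous (fun p : R * 'rV[R]_n => p.1) by move=> p; exact: cvg_fst.
have cy := @entry_continuous R n.
pose hx (p : R * 'rV[R]_n) := mu - p.1 ^+ 2 + \sum_(i < n) p.2 0 i.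
pose hy (p : R * 'rV[R]_n) : 'rV[R]_n :=
  \row_(j < n) if j == 0%N :> nat then b * p.1 else a_ j * p.2 0 (ord_pred j).
move=> p.
apply: (@cvg_pair _ _ _ (nbhs p) (nbhs (hx p)) (nbhs (hy p)) _ _ _ hx hy).
  apply: cvgD; first by apply: cvgB; [exact: cvg_cst|apply: cvgM; exact: cx].
  by apply: cvg_big => [|i _]; [exact: add_continuous|exact: cy].
apply: cvg_mx => i j; rewrite mxE.
under eq_fun do rewrite mxE.
by case: ifP => _; apply: cvgM;
  [exact: cvg_cst|exact: cx|exact: cvg_cst|exact: cy].
Qed.

Lemma l1_continuous (R : realType) (n : nat) :
  continuous (fun p : R * 'rV[R]_n => \sum_(i < n) `|p.2 0 i|).
Proof.
move=> p; apply: cvg_big => [|i _]; first exact: add_continuous.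
exact: cvg_norm (@entry_continuous R n i p).
Qed.

Lemma l1_slab_compact (R : realType) (n : nat) (alpha gamma : R) :
  compact ([set p : R * 'rV[R]_n | \sum_(i < n) `|p.2 0 i| <= gamma] `&`
           [set p | - alpha <= p.1 <= alpha]).
Proof.
pose box : set (R * 'rV[R]_n) := [set` `[- alpha, alpha]] `*`
  [set y : 'rV[R]_n | forall i, [set` `[- gamma, gamma]] (y ord0 i)].
have box_compact : compact box.
  apply: compact_setX; first exact: segment_compact.
  apply: (@rV_compact R n (fun=> [set` `[- gamma, gamma]])) => i.
  exact: segment_compact.
apply: subclosed_compact box_compact _.
  apply: closedI.
    apply: (@preimage_closed _ _ _ [set r | r <= gamma]) => [p _|].
      exact: l1_continuous.
    exact: closed_le.
  have -> : [set p : R * 'rV[R]_n | - alpha <= p.1 <= alpha] =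
      fst @^-1` [set` `[- alpha, alpha]].
    by apply/seteqP; split=> p; rewrite /= in_itv.
  by apply: preimage_closed => [p _|]; [exact: cvg_fst|exact: itv_closed].
move=> p [/= yg xa]; split=> /= [|i]; rewrite in_itv //=.
rewrite -ler_norml; apply: le_trans yg.
by rewrite (bigD1 i) //= lerDl sumr_ge0.
Qed.

(** The new entry 0 is b x and the new entry i + 1 is the i-th old entry
    scaled, so the last old entry is dropped. *)
Lemma henon_l1_bound (R : realType) (n : nat) (mu b a : R) (a_ : nat -> R)
    (p : R * 'rV[R]_n) :
  0 <= a -> (forall i, (1 <= i)%N -> (i <= n - 1)%N -> `|a_ i| < a) ->
  \sum_(i < n) `|(henon mu b a_ p).2 0 i| <=
    `|b| * `|p.1| + a * \sum_(i < n) `|p.2 0 i|.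
Proof.
case: n p => [|n] p a_ge0 a_lt.
  by rewrite !big_ord0 mulr0 addr0 mulr_ge0.
rewrite big_ord_recl big_ord_recr /= mxE /= normrM lerD2l mulrDr.
apply: le_trans (_ : a * \sum_(i < n) `|p.2 0 (widen_ord (leqnSn n) i)| <= _);
  last by rewrite lerDl mulr_ge0.
rewrite mulr_sumr; apply: ler_sum => i _; rewrite mxE /= normrM.
have -> : ord_pred (lift ord0 i) = widen_ord (leqnSn n) i.
  by apply/val_inj; rewrite /= /bump /= add0n modnDr modn_small // ltnS ltnW.
by apply: ler_pM => //; apply/ltW/a_lt; rewrite // subn1.
Qed.

Theorem theorem4 (R : realType) (n : nat) (mu b a : R) (a_ : nat -> R)
    (alpha gamma : R)
    (n_ge1 : (1 <= n)%N)
    (b_lt1 : `|b| < 1)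
    (a_ge0 : 0 <= a)
    (a_lt1 : a < 1)
    (a_bound : forall i : nat, (1 <= i)%N -> (i <= n - 1)%N -> `|a_ i| < a)
    (gamma_gt0 : 0 < gamma)
    (alphaE : alpha = mu - gamma)
    (gammaE : gamma = alpha * `|b| / (1 - a))
    (hsqrt : Num.sqrt (2 * (mu + gamma)) < mu - gamma) :
  has_topological_horseshoe (@henon R n mu b a_).
Proof.
have alpha_gt0 : 0 < alpha by rewrite alphaE (le_lt_trans _ hsqrt) ?sqrtr_ge0.
have alpha_ge0 := ltW alpha_gt0.
have alpha_sqr : 2 * (mu + gamma) < alpha ^+ 2.
  rewrite -alphaE in hsqrt; have mug : 0 <= 2 * (mu + gamma) by lra.
  by rewrite -(sqr_sqrtr mug) ltr_pXn2r // nnegrE ?sqrtr_ge0.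
have gamma_fix : `|b| * alpha + a * gamma = gamma.
  have : gamma * (1 - a) = alpha * `|b|.
    by rewrite {1}gammaE divfK // subr_eq0 eq_sym lt_eqF.
  lra.
pose S := [set p : R * 'rV[R]_n | \sum_(i < n) `|p.2 0 i| <= gamma].
have sum_le p : S p -> `|\sum_(i < n) p.2 0 i| <= gamma.
  by apply: le_trans; exact: ler_norm_sum.
(* The curve to start from is the segment of the x-axis, where y = 0. *)
apply: (@folding_horseshoe R _ _ fst S alpha _ _ alpha_ge0 _ _ _
  (fun t => (t, 0)) (- alpha) alpha) => //=.
- exact: henon_continuous.
- by move=> p; exact: cvg_fst.
- move=> p Sp; rewrite -ler_norml => xp.
  apply: le_trans (henon_l1_bound _ _ _ _ _ _ _ a_ge0 a_bound) _.
  rewrite -[leRHS]gamma_fix lerD //; first exact: ler_wpM2l.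
  exact: ler_wpM2l.
- move=> p /sum_le; rewrite ler_norml => /andP[y1 y2] ->.
  by rewrite expr0n /=; lra.
- move=> p /sum_le; rewrite ler_norml => /andP[y1 y2] xp.
  have -> : p.1 ^+ 2 = alpha ^+ 2 by case: xp => ->; rewrite ?sqrrN.
  lra.
- exact: l1_slab_compact.
- move=> t.
  apply: (@cvg_pair _ _ _ (nbhs t) (nbhs t) (nbhs (0 : 'rV[R]_n)) _ _ _ id).
    exact: cvg_id.
  exact: cvg_cst.
- by rewrite -subr_ge0 opprK addr_ge0.
- move=> t _; rewrite /S /= big1 ?(ltW gamma_gt0) // => i _.
  by rewrite mxE normr0.
Qed.
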